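(* Let $G$ be a connected graph. Then the following hold. (i) $\mu(S(G)) = 2$ if and only if $G \cong P_2$. (ii) $\mu(S(G)) = 4$ if and only if $G\cong P_3$ or $G \cong C_3$. (iii) There exists no connected graph $G$ with $\mu(S(G)) = 3$ or $\mu(S(G)) = 5$.
   Context: All graphs are finite and simple. $P_n$ and $C_n$ denote the path and the cycle on $n$ vertices. The shadow graph $S(G)$ of a graph $G$ is obtained from $G$ by adding, for each vertex $v$ of $G$, a new vertex $v'$ (the shadow vertex of $v$), and joining $v'$ to all neighbours of $v$ in $G$ (shadow vertices are pairwise non-adjacent). For a vertex set $X$ of a graph $H$, two vertices $u,v$ are $X$-visible if there is a shortest $u,v$-path $P$ in $H$ with $V(P)\cap X \subseteq \{u,v\}$. The set $X$ is a mutual-visibility set if every two vertices of $X$ are $X$-visible; $\mu(H)$ is the maximum cardinality of a mutual-visibility set of $H$. *)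

(* Defs.v *)
From mathcomp Require Import all_boot.
From mathcomp Require Import boolp.

Set Implicit Arguments.
Unset Strict Implicit.
Unset Printing Implicit Defensive.

Record sgraph := SGraph {
  vertex :> finType;
  adj : rel vertex;
  adj_sym : symmetric adj;
  adj_irr : irreflexive adj }.

Arguments adj {s} : rename.

Definition connected_graph (G : sgraph) : Prop :=
  (0 < #|G|) /\ forall x y : G, connect adj x y.

Definition graph_iso (G H : sgraph) : Prop :=
  exists2 f : G -> H, bijective f & {mono f : x y / adj x y}.

(* P_n, with vertices 0, ..., n - 1. *)
Definition path_adj (n : nat) : rel 'I_n :=
  fun i j => (i.+1 == j :> nat) || (j.+1 == i :> nat).

Lemma path_adj_sym n : symmetric (@path_adj n).
Proof. by move=> i j; rewrite /path_adj orbC. Qed.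

Lemma path_adj_irr n : irreflexive (@path_adj n).
Proof. by move=> i; rewrite /path_adj orbb gtn_eqF. Qed.

Definition path_graph (n : nat) : sgraph :=
  SGraph (@path_adj_sym n) (@path_adj_irr n).

(* C_n for n >= 3; the conjunct i != j only matters for n = 1, where i + 1 and
   i agree modulo n. *)
Definition cycle_adj (n : nat) : rel 'I_n :=
  fun i j => (i != j) && ((i.+1 %% n == j :> nat) || (j.+1 %% n == i :> nat)).

Lemma cycle_adj_sym n : symmetric (@cycle_adj n).
Proof. by move=> i j; rewrite /cycle_adj eq_sym orbC. Qed.

Lemma cycle_adj_irr n : irreflexive (@cycle_adj n).
Proof. by move=> i; rewrite /cycle_adj eqxx. Qed.

Definition cycle_graph (n : nat) : sgraph :=
  SGraph (@cycle_adj_sym n) (@cycle_adj_irr n).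

(* S(G): inl v is the original vertex v and inr v its shadow v'. *)
Definition shadow_adj (G : sgraph) : rel (G + G)%type :=
  fun a b => match a, b with
             | inl u, inl v => adj u v
             | inl u, inr v => adj u v
             | inr u, inl v => adj u v
             | inr _, inr _ => false
             end.

Lemma shadow_adj_sym (G : sgraph) : symmetric (@shadow_adj G).
Proof. by case=> [u|u] [v|v] //=; rewrite adj_sym. Qed.

Lemma shadow_adj_irr (G : sgraph) : irreflexive (@shadow_adj G).
Proof. by case=> [u|u] //=; rewrite adj_irr. Qed.

Definition shadow (G : sgraph) : sgraph :=
  SGraph (@shadow_adj_sym G) (@shadow_adj_irr G).

(* A u,v-path is given by the sequence p of its vertices after u, so that its
   vertex set is u :: p and its length is size p. *)
Definition uv_path (H : sgraph) (u v : H) (p : seq H) : Prop :=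
  [/\ path adj u p, last u p = v & uniq (u :: p)].

Definition shortest_uv_path (H : sgraph) (u v : H) (p : seq H) : Prop :=
  uv_path u v p /\ forall q : seq H, uv_path u v q -> size p <= size q.

Definition visible (H : sgraph) (X : {set H}) (u v : H) : Prop :=
  exists2 p : seq H, shortest_uv_path u v p &
    forall w : H, w \in u :: p -> w \in X -> w = u \/ w = v.

Definition mutual_visibility_set (H : sgraph) (X : {set H}) : Prop :=
  forall u v : H, u \in X -> v \in X -> u != v -> visible X u v.

Definition mu (H : sgraph) : nat :=
  \max_(X : {set H} | `[< mutual_visibility_set X >]) #|X|.

(* Main.v *)
Require Import Defs.
From mathcomp Require Import all_boot.
From mathcomp Require Import boolp zify.

(** The shadow vertices of a connected graph [G] on [n] vertices form a
    mutual-visibility set of [S(G)], because interior shadow vertices of a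
    shortest path can be replaced by the vertices they shadow; and the [2 deg z]
    neighbours of a vertex [z] in [S(G)] are mutually visible through [z].
    Hence [mu (S(G)) >= max n (2 Delta)], which is at least 6 unless [n <= 5] and
    [Delta <= 2].  A connected graph with [Delta <= 2] is a path or a cycle, since
    its longest path is spanning, so only [P_1, ..., P_5] and [C_3, C_4, C_5]
    remain, and these are settled by computation. *)

Set Implicit Arguments.
Unset Strict Implicit.
Unset Printing Implicit Defensive.

(** * Shortest walks and visibility *)

Section Walks.

Variable H : sgraph.
Implicit Types (u v : H) (p q : seq H) (X : {set H}).

Lemma walk_uv_path u p :
  path adj u p -> exists2 q, uv_path u (last u p) q & size q <= size p.
Proof.
case/shortenP=> q q_path q_uniq q_sub; exists q => //.
by apply: uniq_leq_size q_sub; case/andP: q_uniq.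
Qed.

(** A walk that is shortest among walks repeats no vertex: removing its loops leaves a walk on a
    subset of its vertices, and minimality forces equal size. So visibility can be proved without
    checking uniqueness. *)
Lemma visible_walk X u v p :
    path adj u p -> last u p = v ->
    (forall q, path adj u q -> last u q = v -> size p <= size q) ->
    {in p, forall w, w \in X -> w = u \/ w = v} -> visible X u v.
Proof.
move=> p_path p_last p_min p_free.
exists p; last by move=> w; rewrite inE => /predU1P[-> _|]; [left | exact: p_free].
split; last by move=> r [r_path r_last _]; apply: p_min.
split=> //; case/shortenP: (p_path) (p_last) p_min => r r_path r_uniq r_sub.
move=> r_last p_min; have p_r := p_min r r_path r_last.
have r_uniq' : uniq r by case/andP: r_uniq.
have [_ p_eq] := uniq_min_size r_uniq' r_sub p_r.
have p_uniq : uniq p by rewrite (leq_size_uniq r_uniq' r_sub p_r).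
by move: r_uniq; rewrite /= p_uniq r_uniq' !andbT p_eq.
Qed.

Lemma shortest_walk u v :
    connect adj u v ->
  exists p, [/\ path adj u p, last u p = v &
    forall q, path adj u q -> last u q = v -> size p <= size q].
Proof.
case/connectP=> p0 p0_path v_last.
pose P k := `[< exists p, [/\ size p = k, path adj u p & last u p = v] >].
have exP : exists k, P k by exists (size p0); apply/asboolP; exists p0.
case: (ex_minnP exP) => k /asboolP[p [<- p_path p_last]] k_min.
exists p; split=> // q q_path q_last.
by apply: k_min; apply/asboolP; exists q.
Qed.

Lemma visible_adj X u v : adj u v -> u != v -> visible X u v.
Proof.
move=> uv u_v; apply: (@visible_walk _ _ _ [:: v]) => /=.
- by rewrite uv.
- by [].
- by case=> //= _ u_eq; rewrite u_eq eqxx in u_v.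
- by move=> w; rewrite inE => /eqP -> _; right.
Qed.

Lemma visible_common_neighbor X u v w :
  u != v -> w \notin X -> adj u w -> adj w v -> visible X u v.
Proof.
move=> u_v wX uw wv; have [uv|uv] := boolP (adj u v); first exact: visible_adj.
apply: (@visible_walk _ _ _ [:: w; v]) => /=.
- by rewrite uw wv.
- by [].
- case=> [_ /= u_eq|a [|//]]; first by rewrite u_eq eqxx in u_v.
  by rewrite /= andbT => ua a_eq; rewrite -a_eq ua in uv.
- move=> z; rewrite !inE => /orP[/eqP ->|/eqP -> _]; last by right.
  by rewrite (negbTE wX).
Qed.

Lemma leq_mu_set X : mutual_visibility_set X -> #|X| <= mu H.
Proof.
move=> X_mv; apply: (@leq_bigmax_cond _ _ (fun X : {set H} => #|X|)).
exact/asboolP.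
Qed.

End Walks.

(** * Deciding mutual visibility by enumeration *)

Section Computation.

Variables (H : sgraph) (s : seq H).
Hypotheses (s_uniq : uniq s) (s_all : forall x, x \in s).
Implicit Types (u v : H) (X : {set H}) (Y : seq H).

(* The endpoints of the walks of length k from u whose later vertices satisfy A. *)
Fixpoint reach (A : pred H) (k : nat) (u : H) : seq H :=
  if k is k'.+1 then
    let r := reach A k' u in [seq v <- s | A v && has (adj^~ v) r]
  else [:: u].

Lemma reachP A k u v :
  reflect (exists p, [/\ size p = k, path adj u p, last u p = v & all A p])
          (v \in reach A k u).
Proof.
elim: k v => [|k IHk] v /=.
  rewrite inE; apply: (iffP eqP) => [->|[p [/size0nil-> _ <- _]]] //.
  by exists [::].
rewrite mem_filter s_all andbT.
apply: (iffP andP) => [[Av /hasP[w /IHk[p [p_size p_path p_last pA]] wv]]|].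
  exists (rcons p v).
  by rewrite size_rcons last_rcons rcons_path all_rcons p_size p_last p_path Av.
case=> p; case/lastP: p => [[]//|p w].
rewrite size_rcons last_rcons rcons_path all_rcons.
case=> [[p_size] /andP[p_path p_last] <- /andP[-> pA]]; split=> //.
by apply/hasP; exists (last u p) => //; apply/IHk; exists p.
Qed.

(** The witness [k] is the distance from [u] to [v]; it is less than [size s] because a path repeats
    no vertex. The start [u] needs no exemption from [Y], as [reach] tests only the later
    vertices. *)
Definition visibleb (Y : seq H) (u v : H) : bool :=
  has (fun k => (v \in reach [pred w | (w == v) || (w \notin Y)] k u)
                && all (fun j => v \notin reach predT j u) (iota 0 k))
      (iota 0 (size s)).

Lemma visibleP X Y u v : X =i Y -> reflect (visible X u v) (visibleb Y u v).
Proof.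
move=> XY; apply: (iffP hasP) => [[k _ /andP[/reachP[p [p_size p_path p_last pA]]]]|].
  move/allP=> k_min; apply: (visible_walk p_path p_last) => [q q_path q_last|w w_p].
    rewrite p_size leqNgt; apply/negP=> q_k.
    have := k_min (size q); rewrite mem_iota q_k => /(_ isT)/reachP[].
    by exists q; split=> //; exact/allP.
  by have /= /orP[/eqP->|] := allP pA w w_p; [right | rewrite -XY => /negbTE->].
case=> p [[p_path p_last p_uniq] p_min] p_free; exists (size p).
  by rewrite mem_iota; apply: (uniq_leq_size p_uniq) => w _; apply: s_all.
apply/andP; split.
  apply/reachP; exists p; split=> //; apply/allP=> w w_p /=.
  rewrite -XY; have [wX|_] := boolP (w \in X); last by rewrite orbT.
  case: (p_free w _ wX); rewrite ?inE ?w_p ?orbT // => w_eq; last by rewrite w_eq eqxx.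
  by move: p_uniq; rewrite /= -w_eq w_p.
apply/allP=> j; rewrite mem_iota => /= j_p.
apply/negP=> /reachP[q [q_size q_path q_last _]].
have [r] := walk_uv_path q_path; rewrite q_last => /p_min p_r r_q.
by move: j_p; rewrite ltnNge -q_size (leq_trans p_r r_q).
Qed.

Definition mutual_visibilityb (Y : seq H) : bool :=
  all (fun u => all (fun v => (u == v) || visibleb Y u v) Y) Y.

Lemma mutual_visibilityP X Y :
  X =i Y -> reflect (mutual_visibility_set X) (mutual_visibilityb Y).
Proof.
move=> XY; apply: (iffP allP) => [Y_mv u v uX vX u_v|X_mv u uY].
  have := allP (Y_mv u _) v; rewrite -!XY uX (negbTE u_v) => /(_ isT vX).
  by move/(visibleP u v XY).
apply/allP=> v vY; have [//|u_v /=] := eqVneq u v.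
by apply/(visibleP u v XY); apply: X_mv; rewrite ?XY.
Qed.

Lemma leq_mu Y : uniq Y -> mutual_visibilityb Y -> size Y <= mu H.
Proof.
move=> Y_uniq Y_mv; pose X := [set x in Y].
have XY : X =i Y by move=> x; rewrite inE.
rewrite -(card_uniqP Y_uniq) -(eq_card XY); apply: leq_mu_set.
exact/(mutual_visibilityP XY).
Qed.

Fixpoint subseqs (T : Type) (t : seq T) : seq (seq T) :=
  if t is x :: t' then
    let r := subseqs t' in r ++ [seq x :: y | y <- r]
  else [:: [::]].

Lemma filter_subseqs (T : eqType) (a : pred T) (t : seq T) :
  filter a t \in subseqs t.
Proof.
elim: t => //= x t IHt; rewrite mem_cat.
by case: ifP => _; rewrite ?IHt // map_f ?orbT.
Qed.

(** Filtering [s] by membership in a vertex set lists that set, so the subsequences of [s] account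
    for all vertex sets. *)
Lemma mu_leq m :
  all (fun Y => mutual_visibilityb Y ==> (size Y <= m)) (subseqs s) -> mu H <= m.
Proof.
move=> /allP s_m; apply/bigmax_leqP=> X /asboolP X_mv.
pose Y := filter [in X] s.
have XY : X =i Y by move=> x; rewrite mem_filter s_all andbT.
have := s_m Y (filter_subseqs _ _).
rewrite (introT (mutual_visibilityP XY) X_mv) /=.
by rewrite (eq_card XY) (card_uniqP (filter_uniq _ s_uniq)).
Qed.

End Computation.

(** * Invariance under isomorphism *)

Section Isomorphism.

Lemma graph_iso_sym (G H : sgraph) : graph_iso G H -> graph_iso H G.
Proof.
case=> f [g fK gK] f_mono; exists g; first by exists f.
by move=> x y; rewrite -f_mono !gK.
Qed.

Lemma graph_iso_shadow (G H : sgraph) :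
  graph_iso G H -> graph_iso (shadow G) (shadow H).
Proof.
case=> f [g fK gK] f_mono.
pose lift (A B : sgraph) (h : A -> B) (z : shadow A) : shadow B :=
  match z with inl x => inl (h x) | inr x => inr (h x) end.
exists (lift G H f); last by case=> [x|x] [y|y] /=; rewrite ?f_mono.
by exists (lift H G g); case=> x; rewrite /= ?fK ?gK.
Qed.

Lemma mu_iso_leq (G H : sgraph) : graph_iso G H -> mu G <= mu H.
Proof.
case=> f [g fK gK] f_mono; have f_inj := can_inj fK; have g_inj := can_inj gK.
have g_mono : {mono g : x y / adj x y} by move=> x y; rewrite -f_mono !gK.
apply/bigmax_leqP=> X /asboolP X_mv.
rewrite -(card_imset [in X] f_inj); apply: leq_mu_set.
move=> _ _ /imsetP[u uX ->] /imsetP[v vX ->]; rewrite (inj_eq f_inj) => u_v.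
have [p [[p_path p_last p_uniq] p_min] p_free] := X_mv u v uX vX u_v.
exists (map f p).
  split=> [|q [q_path q_last q_uniq]].
    split; last by rewrite -map_cons map_inj_uniq.
      by rewrite path_map (eq_path f_mono).
    by rewrite last_map p_last.
  rewrite size_map -(size_map g q); apply: p_min.
  rewrite -(fK u); split; last by rewrite -map_cons map_inj_uniq.
    by rewrite path_map (eq_path g_mono).
  by rewrite last_map q_last fK.
move=> w; rewrite -map_cons => /mapP[z z_p ->]; rewrite mem_imset // => zX.
by case: (p_free z z_p zX) => ->; [left | right].
Qed.

Lemma mu_iso (G H : sgraph) : graph_iso G H -> mu G = mu H.
Proof.
move=> GH; apply/eqP; rewrite eqn_leq mu_iso_leq //.
exact/mu_iso_leq/graph_iso_sym.
Qed.

End Isomorphism.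

(** * Lower bounds from the degree and from the order *)

Definition neighbors (G : sgraph) (z : G) : {set G} := [set y | adj z y].

Section LowerBounds.

Variable G : sgraph.

Definition original (z : shadow G) : G := match z with inl x => x | inr x => x end.

Lemma mu_shadow_neighbors (z : G) : 2 * #|neighbors z| <= mu (shadow G).
Proof.
pose X : {set shadow G} := inl @: neighbors z :|: inr @: neighbors z.
have X_adj x : x \in X -> adj z (original x).
  by rewrite inE => /orP[] /imsetP[y]; rewrite inE => zy ->.
have card_X : #|X| = 2 * #|neighbors z|.
  rewrite cardsU !card_imset; try by move=> ? ? [].
  rewrite (_ : _ :&: _ = set0) ?cards0 ?subn0 ?addnn ?mul2n //.
  apply/setP=> x; rewrite !inE; apply/negP=> /andP[].
  by case/imsetP=> a _ -> /imsetP[].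
rewrite -card_X; apply: leq_mu_set => u v /X_adj zu /X_adj zv u_v.
apply: (@visible_common_neighbor _ _ _ _ (inl z : shadow G)) => //.
- by apply/negP=> /X_adj; rewrite adj_irr.
- by rewrite adj_sym; case: u zu {u_v}.
- by case: v zv {u_v}.
Qed.

Lemma connect_shadow (x y : G) :
    (forall u v : G, connect adj u v) -> x != y ->
  connect (@adj (shadow G)) (inr x) (inr y).
Proof.
move=> G_conn x_y.
have inl_conn a b : connect (@adj (shadow G)) (inl a) (inl b).
  have /connectP[p p_path ->] := G_conn a b.
  apply/connectP; exists [seq inl c | c <- p]; last by rewrite last_map.
  by rewrite path_map.
(* The vertex [b] only ensures that [a] has a neighbour [d]; the shadow of [a] leaves through
   [d]. *)
have inr_conn a b c : a != b -> connect (@adj (shadow G)) (inr a) (inl c).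
  have /connectP[[|d p]] := G_conn a b; first by move=> _ /= ->; rewrite eqxx.
  case/andP=> ad _ _ _.
  exact: connect_trans (connect1 (ad : @adj (shadow G) (inr a) (inl d))) (inl_conn d c).
apply: (connect_trans (inr_conn _ _ x x_y)).
rewrite (sym_connect_sym (@adj_sym (shadow G))).
by rewrite (inr_conn _ x) // eq_sym.
Qed.

(** Adjacency in S(G) survives replacing either endpoint of an edge by its original. Only the
    interior [q] is projected, so the ends and the length of the walk are kept. *)
Lemma original_walk (a z : shadow G) q :
    path adj a (rcons q z) ->
  path adj a (rcons [seq inl (original w) | w <- q] z).
Proof.
have adjl b c : @adj (shadow G) b c -> @adj (shadow G) (inl (original b)) c.
  by case: b => b; case: c.
have adjr b c : @adj (shadow G) b c -> @adj (shadow G) b (inl (original c)).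
  by case: b => b; case: c.
have walkl b r : @path (shadow G) adj b (rcons r z) ->
    @path (shadow G) adj (inl (original b)) (rcons [seq inl (original w) | w <- r] z).
  elim: r b => [|c r IHr] b /=; first by rewrite !andbT; apply: adjl.
  by case/andP=> bc /IHr ->; rewrite andbT; exact: adjl (adjr _ _ bc).
case: q => [|b q] //= /andP[ab /walkl ->].
by rewrite andbT; apply: adjr.
Qed.

Lemma mu_shadow_order : (forall u v : G, connect adj u v) -> #|G| <= mu (shadow G).
Proof.
move=> G_conn; have inr_inj : injective (inr : G -> shadow G) by move=> ? ? [].
rewrite -cardsT -(card_imset _ inr_inj); apply: leq_mu_set.
move=> _ _ /imsetP[x _ ->] /imsetP[y _ ->]; rewrite (inj_eq inr_inj) => x_y.
have [p] := shortest_walk (connect_shadow G_conn x_y).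
case/lastP: p => [[_ /inr_inj x_eq _]|q z]; first by rewrite x_eq eqxx in x_y.
rewrite last_rcons => -[q_path z_eq q_min]; subst z.
apply: (visible_walk (original_walk q_path)); first by rewrite last_rcons.
  by move=> r r_path /(q_min r r_path); rewrite !size_rcons size_map.
move=> w; rewrite mem_rcons inE => /predU1P[->|/mapP[a _ ->]]; first by right.
by case/imsetP.
Qed.

End LowerBounds.

(** * Connected graphs of maximum degree at most two *)

Section PathsAndCycles.

Lemma degree_gt2 (G : sgraph) (z a b c : G) :
  adj z a -> adj z b -> adj z c -> uniq [:: a; b; c] -> 2 < #|neighbors z|.
Proof.
move=> za zb zc /card_uniqP abc; rewrite -[3]/(size [:: a; b; c]) -abc.
apply/subset_leq_card/subsetP=> w.
by rewrite !inE => /or3P[] /eqP ->.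
Qed.

Lemma longest_path (G : sgraph) :
    0 < #|G| ->
  exists (x : G) (p : seq G), [/\ path adj x p, uniq (x :: p) &
    forall (y : G) q, path adj y q -> uniq (y :: q) -> size q <= size p].
Proof.
case/card_gt0P=> x0 _.
pose P k := `[< exists (x : G) (p : seq G), [/\ size p = k, path adj x p & uniq (x :: p)] >].
have exP : exists k, P k by exists 0; apply/asboolP; exists x0, [::].
have leP k : P k -> k <= #|G|.
  by case/asboolP=> x [p [<- _ /card_uniqP p_size]]; rewrite ltnW // -[_.+1]p_size max_card.
case: (ex_maxnP exP leP) => k /asboolP[x [p [<- p_path p_uniq]]] k_max.
exists x, p; split=> // y q q_path q_uniq.
by apply: k_max; apply/asboolP; exists y, q.
Qed.

(** The vertex set of a longest path is closed under adjacency, hence everything: a neighbour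
    outside it would extend the path at an end, or give an inner vertex degree 3. *)
Lemma spanning_path (G : sgraph) :
    connected_graph G -> (forall z : G, #|neighbors z| <= 2) ->
  exists (x : G) (p : seq G), [/\ path adj x p, uniq (x :: p) & forall y, y \in x :: p].
Proof.
move=> [G_gt0 G_conn] G_deg.
have [x [p [p_path p_uniq p_max]]] := longest_path G_gt0.
exists x, p; split=> // y.
suff p_closed : closed adj [in x :: p].
  by rewrite -(closed_connect p_closed (G_conn x y)) mem_head.
apply: (intro_closed (sym_connect_sym (@adj_sym G))) => z w zw z_p.
apply: contraT => w_p.
move: z_p; rewrite inE => /predU1P[z_x|z_p].
  have /= := p_max w (x :: p); rewrite -{1}z_x adj_sym zw p_path.
  by rewrite -/(uniq (x :: p)) w_p p_uniq ltnn => /(_ isT isT).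
case/splitPr: z_p p_path p_uniq p_max w_p => p1 [|c p2].
  rewrite cats1 => p_path p_uniq p_max w_p.
  have := p_max x (rcons (rcons p1 z) w).
  rewrite rcons_path p_path last_rcons zw -rcons_cons rcons_uniq w_p p_uniq.
  by rewrite !size_rcons ltnn => /(_ isT isT).
(* Here [z] is an inner vertex, with neighbours [last x p1] and [c] on the path and [w] outside
   it. *)
rewrite cat_path /= => /and4P[_ bz zc _] p_uniq _ w_p.
have := G_deg z; rewrite leqNgt (@degree_gt2 _ z (last x p1) c w) //.
  by rewrite adj_sym.
have {}p_uniq : uniq ((x :: p1) ++ [:: z, c & p2]) by [].
have w_neq d : d \in (x :: p1) ++ [:: z, c & p2] -> d != w.
  by move=> d_p; apply: contraNneq w_p => <-.
rewrite /= !inE !negb_or !w_neq ?mem_cat ?mem_last ?inE ?eqxx ?orbT // !andbT.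
apply: contraTneq p_uniq => b_c; apply/negP; rewrite cat_uniq => /and3P[_ /hasP[]].
exists c; first by rewrite !inE eqxx orbT.
by rewrite -b_c; apply: mem_last.
Qed.

(* The only possible edge outside the spanning path joins its two ends, as any
   other one would create a vertex of degree 3. *)
Lemma path_or_cycle (G : sgraph) :
    connected_graph G -> (forall z : G, #|neighbors z| <= 2) ->
  graph_iso G (path_graph #|G|) \/
  2 < #|G| /\ graph_iso G (cycle_graph #|G|).
Proof.
move=> G_conn G_deg; have [x [p [p_path p_uniq p_all]]] := spanning_path G_conn G_deg.
have <- : size (x :: p) = #|G|.
  by rewrite -(card_uniqP p_uniq); apply: eq_card => y; rewrite p_all.
set t := x :: p in p_uniq p_all *; set n := size t.
pose h (i : nat) : G := nth x t i.
have h_inj i j : i < n -> j < n -> (h i == h j) = (i == j).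
  by move=> i_n j_n; apply: nth_uniq.
have hS i : i.+1 < n -> adj (h i) (h i.+1) by move: i; apply/(pathP x).
have h_bij : bijective (fun i : 'I_n => h i).
  exists (fun y => Ordinal (etrans (index_mem y t) (p_all y))) => [i|y].
    by apply: val_inj; rewrite -[LHS]/(index (h i) t) index_uniq.
  by rewrite /h nth_index.
have deg3 i a b c : a < n -> b < n -> c < n -> uniq [:: a; b; c] ->
    adj (h i) (h a) -> adj (h i) (h b) -> adj (h i) (h c) -> False.
  move=> a_n b_n c_n abc ia ib ic; have := G_deg (h i).
  rewrite leqNgt (degree_gt2 ia ib ic) //.
  by move: abc; rewrite /= !inE !h_inj.
have chord i j : i < j -> j < n -> adj (h i) (h j) ->
    (j == i.+1) || (i == 0) && (j == n.-1).
  move=> i_j j_n ij; have [//|j_i /=] := eqVneq j i.+1.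
  case: i i_j ij j_i => [|i] i_j ij j_i; last first.
    (* If the left end of the chord is not the start of the path, it has both its path neighbours
       and [j]. *)
    case: (@deg3 i.+1 i i.+2 j) => //; try by lia.
    - by rewrite /= !inE; lia.
    - by rewrite adj_sym hS //; lia.
    - by apply: hS; lia.
  apply/eqP; case: (ltngtP j n.-1) => // j_n'; last by lia.
  case: j i_j j_n j_n' ij j_i => // j _ j_n j_n' ij j_i.
  (* If the right end is not the last vertex, it has both its path neighbours and vertex 0. *)
  case: (@deg3 j.+1 0 j j.+2) => //; try by lia.
  - by rewrite /= !inE; lia.
  - by rewrite adj_sym.
  - by rewrite adj_sym hS //; lia.
  - by apply: hS; lia.
(* For [n = 2] the ends are joined by the path edge itself, so the guard leaves this case to the
   paths. *)
have [ends|ends] := boolP ((2 < n) && adj (h 0) (h n.-1)); [right|left].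
  case/andP: ends => n_gt2 ends; split=> //.
  apply: graph_iso_sym; exists (fun i : 'I_n => h i) => // i j.
  wlog i_j : i j / i < j.
    move=> IH; case: (ltngtP i j) => [/IH //|/IH|/val_inj ->]; last by rewrite !adj_irr.
    by rewrite adj_sym [RHS]adj_sym.
  have j_n := ltn_ord j.
  rewrite /= /cycle_adj; have -> /= : i != j by rewrite -val_eqE ltn_eqF.
  rewrite modn_small; last by lia.
  apply/idP/idP => [/(chord _ _ i_j j_n) /orP[/eqP ->|/andP[/eqP-> /eqP->]]|].
  - by rewrite eqxx.
  - by rewrite prednK ?modnn ?eqxx ?orbT //; lia.
  - case/orP=> [/eqP <-|]; first by apply: hS; lia.
    (* As [i < j], the successor of [j] modulo [n] can equal [i] only by wrapping around to 0. *)
    have [j_n'|j_n'] := ltnP j.+1 n; first by rewrite modn_small //; lia.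
    have -> : j = n.-1 :> nat by lia.
    by rewrite prednK ?modnn; [move/eqP <- | lia].
apply: graph_iso_sym; exists (fun i : 'I_n => h i) => // i j.
wlog i_j : i j / i < j.
  move=> IH; case: (ltngtP i j) => [/IH //|/IH|/val_inj ->]; last by rewrite !adj_irr.
  by rewrite adj_sym [RHS]adj_sym.
have j_n := ltn_ord j.
rewrite /= /path_adj; apply/idP/idP => [ij|].
  have /orP[/eqP ->|/andP[/eqP i0 /eqP jn]] := chord _ _ i_j j_n ij; first by rewrite eqxx.
  (* The edge joins the two ends, so the failed test gives [n <= 2], where the ends are
     consecutive. *)
  move: ends; rewrite negb_and -{2}i0 -jn ij orbF; lia.
case/orP=> [/eqP i_eq|]; last by lia.
by rewrite -i_eq; apply: hS; lia.
Qed.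

End PathsAndCycles.

(** * Computable bounds for shadows of concrete graphs *)

Section SmallGraphs.

Variables (n : nat) (e : rel 'I_n.+1) (e_sym : symmetric e) (e_irr : irreflexive e).

Let H := shadow (SGraph e_sym e_irr).

(** Reducing indices modulo [n.+1] makes every natural number a vertex, so that sets can be given by
    plain lists: [a] for originals, [b] for shadows. *)
Definition shadow_subset (a b : seq nat) : seq H :=
  let ord i := Ordinal (ltn_pmod i (ltn0Sn n)) in
  [seq inl (ord i) | i <- a] ++ [seq inr (ord i) | i <- b].

Definition shadow_vertices : seq H := shadow_subset (iota 0 n.+1) (iota 0 n.+1).

Lemma mem_shadow_vertices (z : H) : z \in shadow_vertices.
Proof.
have ordE (i : 'I_n.+1) : i = Ordinal (ltn_pmod i (ltn0Sn n)).
  by apply: val_inj; rewrite /= modn_small.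
have iP (i : 'I_n.+1) : val i \in iota 0 n.+1 by rewrite mem_iota /=.
by rewrite mem_cat; apply/orP; case: z => i; [left | right];
  apply/mapP; exists (val i); rewrite // -ordE.
Qed.

Definition mu_shadow_leqb (m : nat) : bool :=
  uniq shadow_vertices &&
  all (fun Y => mutual_visibilityb shadow_vertices Y ==> (size Y <= m))
      (subseqs shadow_vertices).

Lemma mu_shadow_leq m : mu_shadow_leqb m -> mu H <= m.
Proof. by case/andP=> s_uniq; apply: mu_leq s_uniq mem_shadow_vertices _. Qed.

Definition leq_mu_shadowb (a b : seq nat) : bool :=
  uniq (shadow_subset a b) &&
  mutual_visibilityb shadow_vertices (shadow_subset a b).

Lemma leq_mu_shadow a b : leq_mu_shadowb a b -> size a + size b <= mu H.
Proof.
case/andP=> Y_uniq Y_mv; have := leq_mu mem_shadow_vertices Y_uniq Y_mv.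
by rewrite size_cat !size_map.
Qed.

End SmallGraphs.

(** * Paths and cycles on at most five vertices *)

Lemma mu_shadow_path1 : mu (shadow (path_graph 1)) <= 1.
(* S(P_1) consists of two isolated vertices, which no path joins. *)
Proof. by apply: mu_shadow_leq; vm_compute. Qed.

Lemma mu_shadow_path2 : mu (shadow (path_graph 2)) = 2.
Proof.
apply/eqP; rewrite eqn_leq; apply/andP; split.
  by apply: mu_shadow_leq; vm_compute.
by apply: (@leq_mu_shadow _ _ _ _ [:: 0; 1] [::]); vm_compute.
Qed.

Lemma mu_shadow_path3 : mu (shadow (path_graph 3)) = 4.
Proof.
apply/eqP; rewrite eqn_leq; apply/andP; split.
  by apply: mu_shadow_leq; vm_compute.
(* This is the neighbourhood of the middle vertex 1 in S(P_3). *)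
by apply: (@leq_mu_shadow _ _ _ _ [:: 0; 2] [:: 0; 2]); vm_compute.
Qed.

Lemma mu_shadow_cycle3 : mu (shadow (cycle_graph 3)) = 4.
Proof.
apply/eqP; rewrite eqn_leq; apply/andP; split.
  by apply: mu_shadow_leq; vm_compute.
(* This is the neighbourhood of the vertex 2 in S(C_3). *)
by apply: (@leq_mu_shadow _ _ _ _ [:: 0; 1] [:: 0; 1]); vm_compute.
Qed.

(** On four or five vertices the general bounds give only 4 or 5, so the set of shadows is enlarged
    by originals: here by the two ends of the path. *)
Lemma mu_shadow_path4 : 6 <= mu (shadow (path_graph 4)).
Proof. by apply: (@leq_mu_shadow _ _ _ _ [:: 0; 3] (iota 0 4)); vm_compute. Qed.

Lemma mu_shadow_cycle4 : 6 <= mu (shadow (cycle_graph 4)).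
Proof. by apply: (@leq_mu_shadow _ _ _ _ [:: 0; 1] (iota 0 4)); vm_compute. Qed.

Lemma mu_shadow_path5 : 6 <= mu (shadow (path_graph 5)).
Proof. by apply: (@leq_mu_shadow _ _ _ _ [:: 0] (iota 0 5)); vm_compute. Qed.

(** The witness has two non-adjacent originals and all shadows except that of their common neighbour
    1. *)
Lemma mu_shadow_cycle5 : 6 <= mu (shadow (cycle_graph 5)).
Proof. by apply: (@leq_mu_shadow _ _ _ _ [:: 0; 2] [:: 0; 2; 3; 4]); vm_compute. Qed.

(** The alternatives have disjoint ranges of values that omit 3 and 5, so all three claims can be
    read off from them. *)
Lemma mu_shadow_cases (G : sgraph) : connected_graph G ->
  [\/ mu (shadow G) <= 1,
      mu (shadow G) = 2 /\ graph_iso G (path_graph 2),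
      mu (shadow G) = 4 /\
        (graph_iso G (path_graph 3) \/ graph_iso G (cycle_graph 3)) |
      6 <= mu (shadow G)].
Proof.
move=> G_conn; have [G_gt0 G_connect] := G_conn.
have [/existsP[z z_deg]|/existsPn G_low] := boolP [exists z : G, 2 < #|neighbors z|].
  constructor 4; apply: leq_trans (mu_shadow_neighbors z).
  by rewrite (leq_mul2l 2 3).
have G_deg (z : G) : #|neighbors z| <= 2 by rewrite leqNgt; apply: G_low.
have G_mu := mu_shadow_order G_connect.
have mu_eq H (GH : graph_iso G H) := mu_iso (graph_iso_shadow GH).
have := path_or_cycle G_conn G_deg; move: G_gt0 G_mu.
(* Cycles on fewer than three vertices are discarded; the last two goals have order at least 6,
   where the shadows suffice. *)
case: #|G| => [|[|[|[|[|[|n]]]]]] // _ G_mu [GH|[// _ GH]].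
- by constructor 1; rewrite (mu_eq _ GH) mu_shadow_path1.
- by constructor 2; rewrite (mu_eq _ GH) mu_shadow_path2.
- by constructor 3; rewrite (mu_eq _ GH) mu_shadow_path3; split; [|left].
- by constructor 3; rewrite (mu_eq _ GH) mu_shadow_cycle3; split; [|right].
- by constructor 4; rewrite (mu_eq _ GH) mu_shadow_path4.
- by constructor 4; rewrite (mu_eq _ GH) mu_shadow_cycle4.
- by constructor 4; rewrite (mu_eq _ GH) mu_shadow_path5.
- by constructor 4; rewrite (mu_eq _ GH) mu_shadow_cycle5.
- by constructor 4; exact: leq_trans G_mu.
- by constructor 4; exact: leq_trans G_mu.
Qed.

Theorem proposition4p6 (G : sgraph) (hG : connected_graph G) :
  (mu (shadow G) = 2 <-> graph_iso G (path_graph 2)) /\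
  (mu (shadow G) = 4 <->
     graph_iso G (path_graph 3) \/ graph_iso G (cycle_graph 3)) /\
  ~ (exists H : sgraph,
       connected_graph H /\ (mu (shadow H) = 3 \/ mu (shadow H) = 5)).
Proof.
split; [|split].
- split=> [mu2|/graph_iso_shadow/mu_iso ->]; last exact: mu_shadow_path2.
  by case: (mu_shadow_cases hG) => [|[]|[]|] //; rewrite mu2.
- split=> [mu4|[] /graph_iso_shadow/mu_iso ->].
  + by case: (mu_shadow_cases hG) => [|[]|[]|] //; rewrite mu4.
  + exact: mu_shadow_path3.
  + exact: mu_shadow_cycle3.
- by case=> H [/mu_shadow_cases H_cases [] mu_H]; case: H_cases => [|[]|[]|]; rewrite mu_H.
Qed.
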